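(* Let $\{(X_n,d_n,\mu_n)\}_{n=1}^{\infty}$ be a L\'evy family with $\inf_{n\in\mathbb{N}}m_n>0$, where $m_n=\mu_n(X_n)$, and let $\{Y_n\}_{n=1}^{\infty}$ be a sequence of metric spaces satisfying the following conditions (1)–(3). (1) For each $n$, $X_n=\operatorname{Supp}\mu_n$ and $X_n$ is connected. (2) For any $r>0$ and $n\in\mathbb{N}$, all closed balls of radius $r$ in $X_n$ have the same $\mu_n$-measure. (3) For each $n\in\mathbb{N}$, there exists an isometric embedding from $X_n$ to $Y_n$. Then, for any $\kappa$ with $0<\kappa<\inf_{n\in\mathbb{N}}m_n$, we have $$\liminf_{n\to\infty}\operatorname{diam}(X_n\stackrel{\mathrm{Lip}_1}{\longrightarrow}Y_n,m_n-\kappa)\ge\frac12\liminf_{n\to\infty}\operatorname{diam}X_n.$$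
   Context: An mm-space is a triple $(X,d,\mu)$ where $d$ is a complete separable metric on the set $X$ and $\mu$ is a finite Borel measure on $(X,d)$; its total measure is $m=\mu(X)$. For a finite Borel measure $\nu$ on a metric space $Y$ with $m=\nu(Y)$ and $\kappa>0$, the partial diameter is $\operatorname{diam}(\nu,m-\kappa):=\inf\{\operatorname{diam} Y_0\mid Y_0\subseteq Y \text{ Borel},\ \nu(Y_0)\ge m-\kappa\}$. For an mm-space $X$ with total measure $m$, a metric space $Y$ and $\kappa>0$, the observable diameter is $\operatorname{diam}(X\stackrel{\mathrm{Lip}_1}{\longrightarrow}Y,m-\kappa):=\sup\{\operatorname{diam}(f_*(\mu),m-\kappa)\mid f:X\to Y \text{ is a 1-Lipschitz map}\}$. A sequence $\{X_n\}$ of mm-spaces is a L\'evy family if $\operatorname{diam}(X_n\stackrel{\mathrm{Lip}_1}{\longrightarrow}\mathbb{R},m_n-\kappa)\to0$ as $n\to\infty$ for every $\kappa>0$. An isometric embedding is a distance-preserving map. The closed ball is $B_X(x,r)=\{y\in X\mid d(x,y)\le r\}$. *)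

(* Defs.v *)
From HB Require Import structures.
From mathcomp Require Import all_boot all_order all_algebra.
From mathcomp Require Import all_classical all_reals all_analysis.

Set Implicit Arguments.
Unset Strict Implicit.
Unset Printing Implicit Defensive.

Import Order.TTheory GRing.Theory Num.Theory.
Import numFieldNormedType.Exports.

Local Open Scope classical_set_scope.
Local Open Scope ring_scope.

(* As everywhere in the library, complete spaces (and measurable types) are
   pointed, so these spaces are nonempty. *)
#[short(type="completeMetricType")]
HB.structure Definition CompleteMetric (R : numDomainType) :=
  {T of Metric R T & Complete T}.

Definition separable (T : topologicalType) : Prop :=
  exists2 D : set T, countable D & dense D.

Notation borel T := (g_sigma_algebraType (@open T)).

Record mmSpace (R : realType) := MMSpace {
  mm_carrier :> completeMetricType R ;
  mm_separable : separable mm_carrier ;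
  mm_measure : {finite_measure set (borel mm_carrier) -> \bar R}
}.

Section observable_diameter.
Local Open Scope ereal_scope.
Context {R : realType}.
Implicit Types (X : mmSpace R) (Y : metricType R).

Definition total_mass X : \bar R := mm_measure X setT.

(* The maximum with 0 only matters for the empty set, whose diameter is 0. *)
Definition diam Y (A : set Y) : \bar R :=
  maxe 0 (ereal_sup [set (mdist p.1 p.2)%:E | p in A `*` A]).

(* [partial_diam nu kappa] is diam(nu, m - kappa), where m is the total mass
   of nu. Borel sets are given by their generated sigma-algebra, and nu by a
   bare set function, so that Y need not be pointed. *)
Definition partial_diam Y (nu : set Y -> \bar R) (kappa : R) : \bar R :=
  ereal_inf [set diam A | A in
    [set A : set Y | <<s @open Y >> A /\ nu setT - kappa%:E <= nu A]].

Definition lipschitz1 (Z Y : metricType R) (f : Z -> Y) : Prop :=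
  forall x y, (mdist (f x) (f y) <= mdist x y)%R.

Definition isometric_embedding (Z Y : metricType R) (f : Z -> Y) : Prop :=
  forall x y, mdist (f x) (f y) = mdist x y.

(* [obs_diam X Y kappa] is diam(X -Lip_1-> Y, m - kappa), where m is the total
   mass of X; the set function is the pushforward of the measure of X by f. *)
Definition obs_diam X Y (kappa : R) : \bar R :=
  ereal_sup [set partial_diam (fun A => mm_measure X (f @^-1` A)) kappa
            | f in [set f : X -> Y | lipschitz1 f]].

(* [R^o] carries the distance `|y - x|. *)
Definition levy_family (X : nat -> mmSpace R) : Prop :=
  forall kappa : R, (0 < kappa)%R ->
    obs_diam (X n) R^o kappa @[n --> \oo] --> 0.

Definition msupport X : set X :=
  [set x | forall U : set X, open_nbhs x U -> 0 < mm_measure X U].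

(* The library's [closed_ball] is the closure of the open ball, which may be
   smaller than this set in a general metric space. *)
Definition cball Y (x : Y) (r : R) : set Y := [set y | (mdist x y <= r)%R].

End observable_diameter.

Arguments msupport {R} X _.

(* Main.v *)
Require Import Defs.
From HB Require Import structures.
From mathcomp Require Import all_boot all_order all_algebra.
From mathcomp Require Import all_classical all_reals all_analysis.
From mathcomp Require Import lra.

Set Implicit Arguments.
Unset Strict Implicit.
Unset Printing Implicit Defensive.

Import Order.TTheory GRing.Theory Num.Theory.
Import numFieldNormedType.Exports.

Local Open Scope classical_set_scope.
Local Open Scope ring_scope.

(** Fix a space X of the family, of mass m, and let kappa + kappa' < m and
    2 kappa' < m. Let f embed X isometrically in Y and let A be a Borel set of Y
    of finite diameter r whose preimage has mass at least m - kappa. The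
    preimage is nonempty and lies in a closed ball of radius r + eps; since all
    balls of that radius have the same mass, each of them has mass at least
    m - kappa. When the observable diameter of X in the line for kappa' is
    below eps, the distance to x takes values in a set of diameter below eps
    outside a set of mass at most kappa'. This set of values is met on the ball
    of radius r + eps around x, so the ball of radius r + 2 eps has mass at
    least m - kappa' ([obs_diam_cball]). As 2 kappa' < m, any two such balls
    meet, and the diameter of X is at most 2 (r + 2 eps)
    ([half_diam_le_obs_diam]).

    The masses are bounded below by a constant c > kappa, so that kappa' can be
    chosen independently of the index; letting eps tend to 0 compares the two
    lower limits ([limn_einf_le_eps]). *)

Section borel_sets.
Context {R : realType}.
Implicit Types X Y : metricType R.

Lemma lipschitz1_continuous X Y (f : X -> Y) : lipschitz1 f -> continuous f.
Proof.
move=> lipf x; apply/cvg_ballP => e e0; near=> y.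
rewrite ballEmdist/=; apply: le_lt_trans (lipf _ _) _.
suff : ball x e y by rewrite ballEmdist.
by near: y; exact: nbhsx_ballx.
Unshelve. all: by end_near. Qed.

(** The sets whose preimage is Borel form a sigma-algebra containing the open
    sets. Unlike for [measurability], Y need not be pointed. *)
Lemma borel_preimage (X Y : topologicalType) (f : X -> Y) (A : set Y) :
  continuous f -> <<s @open Y >> A -> <<s @open X >> (f @^-1` A).
Proof.
move=> /continuousP cf bA; rewrite -[_ @^-1` _]setTI; move: A bA.
have : sigma_algebra setT (image_set_system setT f <<s @open X >>).
  by apply: sigma_algebra_image; exact: smallest_sigma_algebra.
move=> /smallest_sub; apply => U oU; rewrite /image_set_system/= setTI.
by apply: sub_sigma_algebra; exact: cf.
Qed.

Lemma lipschitz1_mdist X (x : X) : lipschitz1 (mdist x : X -> R^o).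
Proof.
move=> y z.
have -> : mdist (mdist x y : R^o) (mdist x z) = `|mdist x z - mdist x y|
  by [].
have := metric_triangle x y z; have := metric_triangle x z y.
by rewrite (metric_sym z y) ler_norml => *; apply/andP; split; lra.
Qed.

Lemma borel_cball X (x : X) r : <<s @open X >> (cball x r).
Proof.
rewrite -[cball x r]setCK -setTD; apply: sigma_algebraCD.
apply: sub_sigma_algebra.
have -> : ~` cball x r = (mdist x : X -> R^o) @^-1` [set t : R | r < t].
  by apply/seteqP; split => y /=; rewrite ltNge => /negP.
have /continuousP := lipschitz1_continuous (lipschitz1_mdist x).
by apply; exact: open_gt.
Qed.

Lemma le_diam X (A : set X) x y : A x -> A y -> ((mdist x y)%:E <= diam A)%E.
Proof.
move=> Ax Ay; rewrite /diam le_max; apply/orP; right.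
by apply: ereal_sup_ubound; exists (x, y).
Qed.

Lemma diam_ge0 X (A : set X) : (0 <= diam A)%E.
Proof. by rewrite /diam le_max lexx. Qed.

Lemma diam_le X (A : set X) (r : R) : 0 <= r ->
  (forall x y, A x -> A y -> mdist x y <= r) -> (diam A <= r%:E)%E.
Proof.
move=> r0 Ar; rewrite /diam ge_max lee_fin r0/=.
by apply: ge_ereal_sup => _ [[x y] [/= Ax Ay] <-]; rewrite lee_fin Ar.
Qed.

End borel_sets.

(** Only the values of large index matter, and an error that can be made
    arbitrarily small is lost in the lower limit. *)
Lemma limn_einf_le_eps (R : realType) (c : R) (u v : (\bar R)^nat) : 0 < c ->
  (forall e : R, 0 < e -> \forall n \near \oo, (c%:E * u n <= v n + e%:E)%E) ->
  (c%:E * limn_einf u <= limn_einf v)%E.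
Proof.
move=> c0 uv; apply/lee_addgt0Pr => e e0.
rewrite addeC -limn_einf_shift// !limn_einf_lim.
apply: (@lee_cvg_to _ \oo _ _ (fun n => c%:E * einfs u n)%E
  (einfs (fun n => e%:E + v n)%E)); [|exact: is_cvg_einfs|].
  by apply: cvgeZl => //; exact: is_cvg_einfs.
have [N _ Nuv] := uv e e0; near=> n.
apply: le_ereal_inf_tmp => _ [k /= nk <-].
have Nk : (N <= k)%N by apply: leq_trans nk; near: n; exists N.
rewrite addeC; apply: le_trans (Nuv k Nk).
by apply: lee_wpmul2l; [rewrite lee_fin ltW|apply: ereal_inf_lbound; exists k].
Unshelve. all: by end_near. Qed.

Section concentration.
Context {R : realType} (X : mmSpace R).
Local Notation mu := (mm_measure X).

Let fin_mu A : <<s @open X >> A -> mu A \is a fin_num.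
Proof. by move=> bA; apply: fin_num_measure. Qed.

Lemma mm_measure_le (A B : set X) : <<s @open X >> A -> <<s @open X >> B ->
  A `<=` B -> (mu A <= mu B)%E.
Proof. by move=> bA bB; apply: (le_measure mu); rewrite inE. Qed.

Lemma total_mass_fin_num : total_mass X \is a fin_num.
Proof. by apply: fin_num_measure; exact: measurableT. Qed.

Lemma mm_measure_overlap (A B : set X) :
  <<s @open X >> A -> <<s @open X >> B ->
  (total_mass X < mu A + mu B)%E -> A `&` B !=set0.
Proof.
move=> bA bB mAB; apply/set0P/eqP => AB0; move: mAB; apply/negP; rewrite -leNgt.
rewrite -measureU//; apply: mm_measure_le; last exact: subsetT.
- exact: (@measurableU _ (borel X)).
- exact: (@measurableT _ (borel X)).
Qed.

(** Two sets that miss at most [a] and at most [b] of the mass meet when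
    a + b < m. *)
Lemma mm_measure_overlap_sub (A B : set X) (a b : R) :
  <<s @open X >> A -> <<s @open X >> B -> ((a + b)%:E < total_mass X)%E ->
  (total_mass X - a%:E <= mu A)%E -> (total_mass X - b%:E <= mu B)%E ->
  A `&` B !=set0.
Proof.
move=> bA bB; move: (fin_mu bA) (fin_mu bB) total_mass_fin_num => fA fB fT.
move=> abT aA bB'; apply: mm_measure_overlap => //; move: abT aA bB'.
rewrite -(fineK fA) -(fineK fB) -(fineK fT) -!EFinB -EFinD !lte_fin !lee_fin.
by move=> *; lra.
Qed.

(** Concentration of the distance to [x]: when the observable diameter for
    kappa' is below [eps], enlarging by [eps] a ball of mass at least m - kappa
    gives one of mass at least m - kappa'; kappa' may be far below kappa. *)
Lemma obs_diam_cball (x : X) (r kappa kappa' eps : R) :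
  ((kappa + kappa')%:E < total_mass X)%E ->
  (obs_diam X R^o kappa' < eps%:E)%E ->
  (total_mass X - kappa%:E <= mu (cball x r))%E ->
  (total_mass X - kappa'%:E <= mu (cball x (r + eps)))%E.
Proof.
move=> kT oe rT; have lipx := lipschitz1_mdist x.
have : (partial_diam (fun A => mu ((mdist x : X -> R^o) @^-1` A)) kappa'
    < eps%:E)%E.
  apply: le_lt_trans oe; apply: ereal_sup_ubound.
  by exists (mdist x : X -> R^o).
move=> /ereal_inf_lt[_ [A [bA mA] <-] Ae].
have bfA := borel_preimage (lipschitz1_continuous lipx) bA.
have [y [yr yA]] := mm_measure_overlap_sub (borel_cball x r) bfA kT rT mA.
apply: le_trans mA _; apply: mm_measure_le => //; first exact: borel_cball.
move=> z zA; rewrite /cball/=.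
have : ((mdist (mdist x y : R^o) (mdist x z))%:E < eps%:E)%E.
  by apply: le_lt_trans Ae; exact: le_diam.
have -> : mdist (mdist x y : R^o) (mdist x z) = `|mdist x z - mdist x y| by [].
move: yr; rewrite /cball/= lte_fin ltr_norml => yr /andP[_ ?]; lra.
Qed.

(** The quantitative form of the result, for a single space. *)
Lemma half_diam_le_obs_diam (Y : metricType R) (f : X -> Y)
    (kappa kappa' eps : R) : 0 < eps ->
  ((kappa + kappa')%:E < total_mass X)%E ->
  ((kappa' + kappa')%:E < total_mass X)%E ->
  (kappa%:E < total_mass X)%E ->
  (forall r : R, 0 < r -> forall x y : X, mu (cball x r) = mu (cball y r)) ->
  isometric_embedding f -> (obs_diam X R^o kappa' < eps%:E)%E ->
  ((2^-1)%:E * diam [set: X] <= obs_diam X Y kappa + (2 * eps)%:E)%E.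
Proof.
move=> e0 kk'T k'T kT ball isof oe; rewrite -leeBlDr//.
have lipf : lipschitz1 f by move=> x y; rewrite isof.
apply: le_ereal_sup_tmp; eexists; first by exists f.
apply: le_ereal_inf_tmp => _ [A [bA mA] <-]; rewrite leeBlDr//.
have := diam_ge0 A; case dA : (diam A) => [r| |]; last 2 first.
- by move=> _; rewrite addye // ?leey.
- by [].
rewrite lee_fin => r0.
have bfA := borel_preimage (lipschitz1_continuous lipf) bA.
have [x0 Ax0] : f @^-1` A !=set0.
  apply/set0P/eqP => A0; move: mA; rewrite A0 measure0 leeBlDr// add0e.
  by rewrite leNgt kT.
(* The radius is r + eps and not r, which may be 0, because the masses of balls
   are only compared at positive radii. *)
have fAr : f @^-1` A `<=` cball x0 (r + eps).
  move=> y Ay; rewrite /cball/= -isof.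
  have := @le_diam _ _ A _ _ Ax0 Ay; rewrite dA lee_fin; lra.
have big x : (total_mass X - kappa'%:E <= mu (cball x (r + eps + eps)))%E.
  apply: obs_diam_cball kk'T oe _; rewrite (ball _ _ x x0); last lra.
  by apply: le_trans mA _; apply: mm_measure_le => //; exact: borel_cball.
rewrite lee_pdivrMl// -EFinD -EFinM.
apply: diam_le => [|x y _ _]; first lra.
have [z []] := mm_measure_overlap_sub (borel_cball x _) (borel_cball y _) k'T
  (big x) (big y).
rewrite /cball/= (metric_sym y z) => ? ?.
have := metric_triangle x z y; lra.
Qed.

End concentration.

Theorem proposition1p6 (R : realType) (X : nat -> mmSpace R)
    (Y : nat -> metricType R)
    (levyX : levy_family X)
    (mass_gt0 : (0 < ereal_inf (range (fun n => total_mass (X n))))%E)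
    (suppX : forall n, [set: X n] = msupport (X n))
    (connectedX : forall n, connected [set: X n])
    (ballX : forall (r : R) (n : nat), 0 < r -> forall x y : X n,
      mm_measure (X n) (cball x r) = mm_measure (X n) (cball y r))
    (embX : forall n, exists f : X n -> Y n, isometric_embedding f)
    (kappa : R) (kappa_gt0 : 0 < kappa)
    (kappa_lt : (kappa%:E < ereal_inf (range (fun n => total_mass (X n))))%E) :
  ((2^-1)%:E * limn_einf (fun n => diam [set: X n])
    <= limn_einf (fun n => obs_diam (X n) (Y n) kappa))%E.
Proof.
have massE n : (ereal_inf (range (fun n => total_mass (X n)))
    <= total_mass (X n))%E.
  by apply: ereal_inf_lbound; exists n.
have [c kc cX] : exists2 c : R, kappa < c &
    forall n, (c%:E <= total_mass (X n))%E.
  move: kappa_lt massE; case: (ereal_inf _) => [c| |] //.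
    by rewrite lte_fin => kc massE; exists c.
  (* An infinite infimum would contradict the finiteness of the masses. *)
  move=> _ /(_ 0%N); rewrite leye_eq => /eqP T0.
  by have := total_mass_fin_num (X 0%N); rewrite T0.
(* This makes both 2 kappa' and kappa + kappa' less than c. *)
pose kappa' := Num.min (c - kappa) c / 3.
have [k'0 k'c k'k] : [/\ 0 < kappa', kappa' + kappa' < c & kappa + kappa' < c].
  by rewrite /kappa'; case: (leP (c - kappa) c) => ?; split; lra.
apply: limn_einf_le_eps => // e e0.
have e20 : 0 < e / 2 by lra.
have : \forall n \near \oo, (obs_diam (X n) R^o kappa' < (e / 2)%:E)%E.
  exact: (levyX _ k'0 _ (nbhs_open_ereal_lt (f := fun=> e / 2) e20)).
apply: filterS => n oe; have [f isof] := embX n.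
have -> : e = 2 * (e / 2) by lra.
apply: half_diam_le_obs_diam isof oe => //.
- by apply: lt_le_trans (cX n); rewrite lte_fin.
- by apply: lt_le_trans (cX n); rewrite lte_fin.
- by apply: lt_le_trans (cX n); rewrite lte_fin.
- by move=> r r0; exact: ballX.
Qed.
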